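(* Let $\mathcal{K}$ be a finite field, let $\mathbb{F}_r$ be the free group on $r$ generators, and let $\{\theta_k:\mathbb{F}_r\to \mathrm{Mat}_{n_k\times n_k}(\mathcal{K})\}_{k=1}^\infty$ be a convergent sequence of finite dimensional representations satisfying the Atiyah condition. Then there exist a skew field $D$ over the base field $\mathcal{K}$ and a homomorphism $\theta:\mathbb{F}_r\to D$ (that is, a homomorphism into the multiplicative group of non-zero elements of $D$) such that $\theta$ is a limit of $\{\theta_k\}_{k=1}^\infty$ and $\mathrm{Im}(\theta)$ generates $D$. Moreover, if $\theta':\mathbb{F}_r\to D'$ is another generating limit homomorphism of $\{\theta_k\}_{k=1}^\infty$ into a skew field $D'$ over $\mathcal{K}$, then there exists a skew field isomorphism $\pi:D\to D'$ such that $\pi\circ\theta=\theta'$.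
   Context: A finite dimensional representation $\theta_k:\mathbb{F}_r\to \mathrm{Mat}_{n_k\times n_k}(\mathcal{K})$ is a homomorphism of $\mathbb{F}_r$ into the group of invertible $n_k\times n_k$ matrices over $\mathcal{K}$. It is extended linearly to the group algebra $\mathcal{K}\mathbb{F}_r$ and entrywise to matrices, so that for $A\in\mathrm{Mat}_{n\times n}(\mathcal{K}\mathbb{F}_r)$ we have $\theta_k(A)\in \mathrm{Mat}_{n_kn\times n_kn}(\mathcal{K})$. Put $\mathrm{rk}^n_{n_k}(\theta_k(A))=\mathrm{Rank}(\theta_k(A))/n_k$. The sequence is convergent if $\lim_{k\to\infty}\mathrm{rk}^n_{n_k}(\theta_k(A))$ exists for all $n\ge1$ and $A\in \mathrm{Mat}_{n\times n}(\mathcal{K}\mathbb{F}_r)$. It satisfies the Atiyah condition if all these limits are integers. A homomorphism $\theta:\mathbb{F}_r\to D$ into the multiplicative group of a skew field $D$ over $\mathcal{K}$ is extended linearly to $\mathcal{K}\mathbb{F}_r$ and entrywise to matrices. It is a limit of $\{\theta_k\}$ if $\lim_{k\to\infty}\mathrm{rk}^n_{n_k}(\theta_k(A))=\mathrm{rk}^n_D(\theta(A))$ for all $n\ge1$ and $A\in\mathrm{Mat}_{n\times n}(\mathcal{K}\mathbb{F}_r)$, where $\mathrm{rk}^n_D$ is the usual rank of $n\times n$ matrices over the skew field $D$ (with values in $\{0,\dots,n\}$). It is generating if the image of $\mathcal{K}\mathbb{F}_r$ generates $D$ as a skew field, i.e. $D$ is the smallest sub-skew field of $D$ containing this image. *)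

(* Defs.v *)
From HB Require Import structures.
From mathcomp Require Import all_boot all_order all_algebra.
From mathcomp Require Import all_classical all_reals all_analysis.
From mathcomp Require Import finmap.
From mathcomp.multinomials Require Import -(notations) monalg.

Set Implicit Arguments.
Unset Strict Implicit.
Unset Printing Implicit Defensive.

Import Order.TTheory GRing.Theory Num.Theory.
Import numFieldNormedType.Exports.

Local Open Scope classical_set_scope.
Local Open Scope ring_scope.

(* The free group on [r] generators, as the reduced words in the letters
   [(i, b)]: [(i, true)] is the generator [x_i], [(i, false)] its inverse. *)
Section FreeGroup.
Variable r : nat.

Definition letter : Type := 'I_r * bool.
HB.instance Definition _ := Finite.on letter.

Implicit Types (x y : letter) (u v w : seq letter).

Definition letter_inv x : letter := (x.1, ~~ x.2).

Definition reduced w := sorted (fun x y => y != letter_inv x) w.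

Record free_group := FreeGroup { word : seq letter; _ : reduced word }.
HB.instance Definition _ := [isSub for word].
HB.instance Definition _ := [Countable of free_group by <:].

Definition push x w :=
  if w is y :: w' then if y == letter_inv x then w' else x :: w else [:: x].

(* On reduced words this is the reduced form of the concatenation [u ++ v]. *)
Definition word_mul u v := foldr push v u.

Definition word_inv w := rev (map letter_inv w).

Lemma letter_invK : involutive letter_inv.
Proof. by case=> i b; rewrite /letter_inv negbK. Qed.

Lemma reduced_push x w : reduced w -> reduced (push x w).
Proof.
case: w => [|y w] //= yw; case: eqP => [_|/eqP yx].
  exact: path_sorted yw.
by rewrite /= yx.
Qed.

Lemma pushK x w : reduced w -> push x (push (letter_inv x) w) = w.
Proof.
case: w => [|y w] /=; first by rewrite eqxx.
rewrite letter_invK; case: eqP => [->|_ _]; last by rewrite /= eqxx.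
by case: w => [|z w] //= /andP[/negPf-> _].
Qed.

Lemma reduced_mul u v : reduced v -> reduced (word_mul u v).
Proof. by move=> vr; elim: u => //= x u; exact: reduced_push. Qed.

Lemma word_mul_push x u v :
  reduced v -> word_mul (push x u) v = push x (word_mul u v).
Proof.
case: u => [|y u] //= vr; case: eqP => // ->.
by rewrite pushK // reduced_mul.
Qed.

Lemma word_mulA u v w :
  reduced w -> word_mul u (word_mul v w) = word_mul (word_mul u v) w.
Proof. by move=> wr; elim: u => //= x u ->; rewrite word_mul_push. Qed.

Lemma word_mulw1 w : reduced w -> word_mul w [::] = w.
Proof.
elim: w => //= x w IHw xw; rewrite IHw; last exact: path_sorted xw.
by case: w xw {IHw} => [|y w] //= /andP[/negPf-> _].
Qed.

Lemma word_mulVw w : word_mul (word_inv w) w = [::].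
Proof.
elim: w => // x w IHw.
by rewrite /word_inv /= rev_cons /word_mul foldr_rcons /= letter_invK eqxx.
Qed.

Lemma word_invK : involutive word_inv.
Proof.
by move=> w; rewrite /word_inv map_rev revK -map_comp map_id_in // => x _;
  exact: letter_invK.
Qed.

Lemma reduced_inv w : reduced w -> reduced (word_inv w).
Proof.
move=> wr; rewrite /reduced /word_inv rev_sorted sorted_map.
rewrite (eq_sorted (e' := fun x y => y != letter_inv x)) // => x y /=.
by rewrite letter_invK eq_sym.
Qed.

Definition free_one := FreeGroup (isT : reduced [::]).
Definition free_mul (a b : free_group) :=
  FreeGroup (reduced_mul (word a) (valP b)).
Definition free_inv (a : free_group) := FreeGroup (reduced_inv (valP a)).

Lemma free_mulA : associative free_mul.
Proof. by move=> a b c; apply: val_inj; rewrite /= word_mulA ?(valP c). Qed.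

Lemma free_mul1g : left_id free_one free_mul.
Proof. by move=> a; apply: val_inj. Qed.

Lemma free_mulg1 : right_id free_one free_mul.
Proof. by move=> a; apply: val_inj; rewrite /= word_mulw1 ?(valP a). Qed.

Lemma free_mulVg : left_inverse free_one free_inv free_mul.
Proof. by move=> a; apply: val_inj; rewrite /= word_mulVw. Qed.

Lemma free_mulgV : right_inverse free_one free_inv free_mul.
Proof.
move=> a; apply: val_inj => /=.
by rewrite -{1}(word_invK (word a)) word_mulVw.
Qed.

HB.instance Definition _ := isGroup.Build free_group
  free_mulA free_mul1g free_mulg1 free_mulVg free_mulgV.

End FreeGroup.

Section GroupAlgebra.
Variables (K : fieldType) (G : groupType).

(* Finitely supported functions [G -> K].  Only the linear structure is
   used below, so the convolution product is not constructed. *)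
Definition group_algebra := malg G K.

Definition linear_extension (V : lmodType K) (f : G -> V)
    (a : group_algebra) : V :=
  \sum_(g <- msupp a) mcoeff g a *: f g.

Record fd_representation := FdRepresentation {
  fd_dim : nat;
  fd_fun :> G -> 'M[K]_fd_dim;
  fd_dim_gt0 : (0 < fd_dim)%N;
  fd_unit : forall g, fd_fun g \in unitmx;
  fd_one : fd_fun 1%g = 1%:M;
  fd_mul : forall g h, fd_fun (g * h)%g = fd_fun g *m fd_fun h
}.

Definition fd_ext (theta : fd_representation) n (A : 'M[group_algebra]_n) :=
  \mxblock_(i < n, j < n) linear_extension theta (A i j).

Definition fd_rk (R : realType) (theta : fd_representation) n
    (A : 'M[group_algebra]_n) : R :=
  (\rank (fd_ext theta A))%:R / (fd_dim theta)%:R.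

Definition convergent (R : realType) (theta : nat -> fd_representation) :=
  forall n (A : 'M[group_algebra]_n), (0 < n)%N ->
    cvgn (fun k => fd_rk R (theta k) A).

Definition atiyah_condition (R : realType)
    (theta : nat -> fd_representation) :=
  forall n (A : 'M[group_algebra]_n), (0 < n)%N ->
    limn (fun k => fd_rk R (theta k) A) \is a Num.int.

End GroupAlgebra.

Section SkewRank.
Variable D : nzRingType.

Definition left_independent_rows m n (A : 'M[D]_(m, n)) (S : {set 'I_m}) :=
  forall c : 'rV[D]_m,
    (forall i, i \notin S -> c 0 i = 0) -> c *m A = 0 -> c = 0.

(* The maximal number of left linearly independent rows, i.e. the dimension of
   the left row space; over a skew field it is also the dimension of the right
   column space. *)
Definition skew_rank m n (A : 'M[D]_(m, n)) : nat :=
  \max_(S : {set 'I_m} | `[< left_independent_rows A S >]) #|S|.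

End SkewRank.

(* A skew field over [K] is a [K]-algebra, so scalars act centrally, whose
   non-zero elements are all units. *)
Definition skew_field (K : fieldType) (D : unitAlgType K) :=
  forall x : D, x != 0 -> x \is a GRing.unit.

Section SkewFieldHom.
Variables (K : fieldType) (G : groupType) (D : unitAlgType K).
Implicit Type theta : G -> D.

Definition hom_to_nonzero theta :=
  [/\ forall g, theta g != 0,
      theta 1%g = 1 &
      forall g h, theta (g * h)%g = theta g * theta h].

Definition limit_hom (R : realType) (thetas : nat -> fd_representation K G)
    theta :=
  forall n (A : 'M[group_algebra K G]_n), (0 < n)%N ->
    (fun k => fd_rk R (thetas k) A) @ \oo -->
      ((skew_rank (map_mx (linear_extension theta) A))%:R : R).

(* Every division-closed subring containing the image of the group algebra is
   all of [D]; the division convention [x / 0 = 0] is harmless here. *)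
Definition generating theta :=
  forall S : {pred D}, GRing.divring_closed S ->
    (forall a : group_algebra K G, linear_extension theta a \in S) ->
    forall x, x \in S.

End SkewFieldHom.

(* Main.v *)
Require Import Defs.
From HB Require Import structures.
From mathcomp Require Import all_boot all_order all_algebra.
From mathcomp Require Import all_classical all_reals all_analysis.
From mathcomp Require Import perm finmap.
From mathcomp.multinomials Require Import -(notations) monalg.

(** Instead of an ultraproduct, take the algebra of all sequences of matrices
    x k of size d k, modulo the ideal of those with rank (x k) / d k tending to
    0, and send g to the class of the sequence theta_k g.  In this quotient V a
    matrix with entries from the group algebra is invertible as soon as its
    limit rank is full, because a matrix of nearly full rank differs by one of
    small rank from an invertible matrix (rel_rank_full_inverse).

    The skew field D is the rational closure of the group algebra in V: the
    elements c N b, where N inverts a matrix M, and M, the row c and the column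
    b have entries in the image of the group algebra.  These elements always
    form a subalgebra.  The bordered matrix with blocks M, b, c, 0 has limit
    rank m plus the limit rank of c N b, where m is the size of M.  The Atiyah
    condition makes this an integer, so c N b has limit rank 0, and vanishes in
    V, or the bordered matrix has full rank and is invertible
    (limit_rank_dichotomy).  In the second case c N b has an inverse, which can
    be read off the inverse of the bordered matrix and is therefore rational
    again (bordered_rational_inverse).  So the rational closure is a skew field.

    The rank over D of a matrix A is the largest s such that the identity matrix
    of size s factors through A, and the smallest s such that A factors through
    it (skew_rank_factor).  Both factorizations lift to matrices of sequences,
    whose ranks are then comparable up to a negligible error; hence the rank
    over D is the limit rank.

    For uniqueness, let theta and theta' be two limits, in D and D'.  They give
    the same ranks.  Over D * D', a bordered matrix with c N b <> 0 has full
    rank over one factor, thus over both, so it is invertible.  Hence the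
    rational closure of (theta, theta') is a skew field too; it projects
    isomorphically onto D and onto D', because these are generated by the
    images, and it is the graph of the isomorphism
    (equal_rank_isomorphic). *)

Set Implicit Arguments.
Unset Strict Implicit.
Unset Printing Implicit Defensive.

Import Order.TTheory GRing.Theory Num.Theory.
Import numFieldNormedType.Exports.
Local Open Scope ring_scope.

(** * Matrices over non-commutative rings and skew fields *)

(** A relation, because over a non-commutative ring there is no determinant to
    decide invertibility. *)
Definition inverse_mx (A : pzRingType) n (M N : 'M[A]_n) :=
  M *m N = 1%:M /\ N *m M = 1%:M.

Lemma inverse_mxM (A : pzRingType) n (M N M' N' : 'M[A]_n) :
  inverse_mx M N -> inverse_mx M' N' -> inverse_mx (M *m M') (N' *m N).
Proof.
move=> [MN NM] [MN' NM']; split.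
  by rewrite mulmxA -(mulmxA M) MN' mulmx1.
by rewrite mulmxA -(mulmxA N') NM mulmx1.
Qed.

Lemma map_inverse_mx (A A' : pzRingType) (f : {rmorphism A -> A'}) n
    (M N : 'M[A]_n) :
  inverse_mx M N -> inverse_mx (map_mx f M) (map_mx f N).
Proof. by case=> MN NM; split; rewrite -map_mxM ?MN ?NM map_mx1. Qed.

Lemma inverse_block_triangular (A : pzRingType) m n (M N : 'M[A]_m)
    (M' N' : 'M[A]_n) (U : 'M[A]_(m, n)) :
  inverse_mx M N -> inverse_mx M' N' ->
  inverse_mx (block_mx M U 0 M') (block_mx N (- (N *m U *m N')) 0 N').
Proof.
move=> [MN NM] [MN' NM']; rewrite /inverse_mx !mulmx_block.
rewrite !(mulmx0, mul0mx, addr0, add0r) MN NM MN' NM' mulmxN !mulNmx !mulmxA MN.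
by rewrite mul1mx addNr -(mulmxA _ N') NM' mulmx1 subrr !scalar_mx_block.
Qed.

Definition left_injective (A : pzRingType) m n (M : 'M[A]_(m, n)) :=
  forall c : 'rV_m, c *m M = 0 -> c = 0.

Lemma inverse_left_injective (A : pzRingType) n (M N : 'M[A]_n) :
  inverse_mx M N -> left_injective M.
Proof. by move=> [MN _] c cM; rewrite -[c]mulmx1 -MN mulmxA cM mul0mx. Qed.

Section SkewEchelon.
Variables (D : unitRingType) (S : divringClosed D).
Hypothesis skewD : forall x : D, x != 0 -> x \is a GRing.unit.

Let mxOver_block m1 m2 n1 n2 (A : 'M[D]_(m1, n1)) (B : 'M[D]_(m1, n2))
    (C : 'M[D]_(m2, n1)) (E : 'M[D]_(m2, n2)) :
  A \is a mxOver S -> B \is a mxOver S -> C \is a mxOver S ->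
  E \is a mxOver S -> block_mx A B C E \is a mxOver S.
Proof.
move=> /mxOverP AS /mxOverP BS /mxOverP CS /mxOverP ES; apply/mxOverP => i j.
by rewrite mxE; case: splitP => i' _; rewrite mxE; case: splitP.
Qed.

Let mxOver_pid m n r : (pid_mx r : 'M[D]_(m, n)) \is a mxOver S.
Proof. by apply/mxOverP => i j; rewrite mxE rpred_nat. Qed.

Lemma reduce_nonzero_row n (a : 'rV[D]_n.+1) :
  a \is a mxOver S -> a != 0 ->
  exists Q Q' : 'M[D]_n.+1,
    [/\ Q \is a mxOver S, inverse_mx Q Q' & a *m Q = delta_mx 0 0].
Proof.
move=> /mxOverP aS /rV0Pn[j aj0] /=.
pose P : 'M[D]_n.+1 := tperm_mx 0 j.
have PP : inverse_mx P P by split; rewrite -perm_mxM tperm2 perm_mx1.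
have aPE : a *m P = xcol 0 j a by rewrite xcolE.
pose al := a 0 j; pose be : 'rV[D]_n := @rsubmx D 1 1 n (a *m P).
have alU : al \is a GRing.unit by exact: skewD.
have beS : be \is a mxOver S.
  by apply/mxOverP => i k; rewrite mxE aPE !mxE.
have aP : a *m P = row_mx al%:M be.
  rewrite -[LHS](@hsubmxK _ 1 1 n).
  suff -> : @lsubmx D 1 1 n (a *m P) = al%:M by [].
  apply/matrixP=> i k; rewrite !ord1 mxE aPE mxE.
  have -> : lshift n (0 : 'I_1) = 0 by apply: val_inj.
  by rewrite tpermL mxE eqxx.
pose Q2 : 'M[D]_(1 + n) := block_mx (al^-1)%:M (- (al^-1 *: be)) 0 1%:M.
pose Q2' : 'M[D]_(1 + n) := block_mx al%:M be 0 1%:M.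
have Q2K : inverse_mx Q2 Q2'.
  have -> : Q2 = block_mx (al^-1)%:M (- ((al^-1)%:M *m be *m 1%:M)) 0 1%:M.
    by rewrite mulmx1 mul_scalar_mx.
  have [||Q2'Q2 Q2Q2'] :=
    @inverse_block_triangular _ _ _ al%:M (al^-1)%:M 1%:M 1%:M be.
  - by split; rewrite -scalar_mxM (mulrV, mulVr).
  - by split; rewrite mulmx1.
  by split.
exists (P *m Q2), (Q2' *m P); split.
- rewrite mxOverM //; first by apply/mxOverP => i k; rewrite !mxE rpred_nat.
  apply: (@mxOver_block 1 n 1 n); rewrite ?mxOver_scalar ?rpred0 ?rpred1
    ?rpredV //.
    exact: aS.
  by rewrite rpredN mxOverZ // rpredV aS.
- exact: inverse_mxM.
rewrite mulmxA aP (@mul_row_block _ 1 1 n 1 n) mulmx0 addr0 mulmx1.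
rewrite -scalar_mxM mulrV //.
rewrite mulmxN mul_scalar_mx scalerA mulrV // scale1r addNr.
apply/matrixP => i k; rewrite !mxE !ord1 /=.
have -> : (k == 0) = (k == 0%N :> nat) by [].
by case: splitP => l /= kl; rewrite mxE !kl ?ord1.
Qed.

(** Gaussian elimination by column operations makes sense over a skew field and
    stays in any division subring that contains the entries. *)
Lemma left_injective_echelon s n (A : 'M[D]_(s, n)) :
  A \is a mxOver S -> left_injective A ->
  exists Q Q' : 'M[D]_n,
    [/\ Q \is a mxOver S, inverse_mx Q Q', (s <= n)%N & A *m Q = pid_mx s].
Proof.
elim: s n A => [|s IHs] n A AS Ainj.
  exists 1%:M, 1%:M; split; rewrite ?mxOver_scalar ?rpred0 ?rpred1 //.
    by split; rewrite mulmx1.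
  by rewrite mulmx1 flatmx0 [RHS]flatmx0.
have a0 : row 0 A != 0.
  apply/eqP => a0; have := Ainj (delta_mx 0 0); rewrite -rowE => /(_ a0).
  by move/matrixP/(_ 0 0)/eqP; rewrite !mxE !eqxx oner_eq0.
case: n => [|n] in A AS Ainj a0 *; first by rewrite thinmx0 eqxx in a0.
have aS : row 0 A \is a mxOver S.
  by apply/mxOverP => i j; rewrite mxE (mxOverP AS).
have [Q1 [Q1' [Q1S Q1K aQ1]]] := reduce_nonzero_row aS a0.
pose A1 : 'M[D]_(1 + s, 1 + n) := A *m Q1.
have A1S : A1 \is a mxOver S by rewrite mxOverM.
pose v := dlsubmx A1; pose A2 := drsubmx A1.
have A1E : A1 = block_mx 1%:M 0 v A2.
  rewrite -[LHS]submxK; congr (block_mx _ _ _ _); apply/matrixP => i j.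
    have /matrixP/(_ 0 0) := aQ1; rewrite -row_mul !mxE !ord1 eqxx => <-.
    by apply: eq_bigr => k _; congr (A _ _ * Q1 _ _);
      apply: val_inj.
  have /matrixP/(_ 0 (rshift 1 j)) := aQ1.
  rewrite -row_mul !mxE !ord1 [X in _ = X -> _](_ : _ = 0) // => e.
  rewrite -[RHS]e.
  by apply: eq_bigr => k _; congr (A _ _ * Q1 _ _);
    apply: val_inj.
have A2S : A2 \is a mxOver S.
  by apply/mxOverP => i j; rewrite 2!mxE; apply: (mxOverP A1S).
have vS : v \is a mxOver S.
  by apply/mxOverP => i j; rewrite 2!mxE; apply: (mxOverP A1S).
have A2inj : left_injective A2.
  move=> c cA2; have : row_mx (- (c *m v)) c *m A1 = 0.
    rewrite A1E mul_row_block mulmx1 mulmx0 add0r addNr cA2.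
    exact: row_mx0.
  rewrite /A1 mulmxA => cA; have /Ainj : row_mx (- (c *m v)) c *m A = 0.
    by apply: (inverse_left_injective Q1K); exact: cA.
  by rewrite -(@row_mx0 D 1 1 s); case/(@eq_row_mx D 1 1 s).
have [Q2 [Q2' [Q2S Q2K les A2Q2]]] := IHs _ _ A2S A2inj.
pose w := - ((pid_mx s : 'M[D]_(n, s)) *m v).
have wS : w \is a mxOver S by rewrite rpredN mxOverM.
pose Q3 : 'M[D]_(1 + n) := block_mx 1%:M 0 0 Q2.
pose Q4 : 'M[D]_(1 + n) := block_mx 1%:M 0 w 1%:M.
pose Q3' : 'M[D]_(1 + n) := block_mx 1%:M 0 0 Q2'.
pose Q4' : 'M[D]_(1 + n) := block_mx 1%:M 0 (- w) 1%:M.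
have Q3K : inverse_mx Q3 Q3'.
  case: Q2K => Q2K Q2'K; split; rewrite mulmx_block ?Q2K ?Q2'K;
  by rewrite !(mulmx0, mul0mx, mulmx1, addr0, add0r) -scalar_mx_block.
have Q4K : inverse_mx Q4 Q4'.
  split; rewrite mulmx_block;
  rewrite !(mulmx0, mul0mx, mulmx1, mul1mx, addr0, add0r) ?addNr ?subrr;
  by rewrite -scalar_mx_block.
exists (Q1 *m Q3 *m Q4), (Q4' *m (Q3' *m Q1')); split=> //.
- rewrite !mxOverM // (@mxOver_block 1 _ 1 _) ?mxOver_scalar ?rpred0 ?rpred1 //;
  exact: mxOver0 (rpred0 _).
- by apply: inverse_mxM => //; apply: inverse_mxM.
rewrite (_ : A *m _ = A1 *m Q3 *m Q4); last by rewrite !mulmxA.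
rewrite A1E !mulmx_block.
rewrite !(mulmx0, mul0mx, mulmx1, mul1mx, addr0, add0r) A2Q2.
rewrite mulmxN mulmxA pid_mx_id // pid_mx_1 mul1mx subrr.
apply/matrixP => i j; rewrite !mxE.
case: splitP => i' ii'; rewrite !mxE; case: splitP => j' jj';
  rewrite !mxE -?val_eqE /= ii' jj' ?ord1 //= ?add1n ?eqSS ?ltnS //.
Qed.

End SkewEchelon.

Section SkewInverse.
Variable D : unitRingType.
Hypothesis skewD : forall x : D, x != 0 -> x \is a GRing.unit.

Lemma left_injective_inverse (S : {pred D}) n (M : 'M[D]_n) :
  GRing.divring_closed S -> (forall i j, M i j \in S) -> left_injective M ->
  exists2 N : 'M[D]_n, (forall i j, N i j \in S) & inverse_mx M N.
Proof.
move=> Sdiv /mxOverP MS Minj.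
pose S' : divringClosed D :=
  HB.pack (S : D -> bool) (GRing.isDivringClosed.Build D S Sdiv).
have [Q [Q' [QS [QQ' Q'Q] _]]] :=
  @left_injective_echelon _ S' skewD _ _ _ MS Minj.
rewrite pid_mx_1 => MQ; exists Q; first by apply/mxOverP.
by split=> //; rewrite -[M]mulmx1 -QQ' (mulmxA M) MQ mul1mx.
Qed.

Lemma divring_closed_predT : GRing.divring_closed (@predT D).
Proof. by []. Qed.

Lemma left_injective_right_inverse s n (A : 'M[D]_(s, n)) :
  left_injective A -> exists X : 'M[D]_(n, s), A *m X = 1%:M.
Proof.
move=> Ainj.
pose S : divringClosed D :=
  HB.pack (predT : D -> bool)
    (GRing.isDivringClosed.Build D predT divring_closed_predT).
have AS : A \is a mxOver S by apply/mxOverP.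
have [Q [_ [_ _ les AQ]]] := left_injective_echelon skewD AS Ainj.
by exists (Q *m pid_mx s); rewrite mulmxA AQ pid_mx_id // pid_mx_1.
Qed.

End SkewInverse.

(** * The rank over a skew field *)

Section SkewRankTheory.
Variable D : unitRingType.
Hypothesis skewD : forall x : D, x != 0 -> x \is a GRing.unit.

Lemma skew_rank_witness m n (A : 'M[D]_(m, n)) :
  exists2 S : {set 'I_m}, left_independent_rows A S & #|S| = skew_rank A.
Proof.
pose indep := [pred S : {set 'I_m} | `[< left_independent_rows A S >]].
have [|S SA Smax] := @eq_bigmax_cond _ indep (fun S => #|S|).
  apply/card_gt0P; exists finset.set0; apply/asboolP => c c0 _.
  by apply/rowP => i; rewrite mxE c0 ?inE.
by exists S; [apply/asboolP | rewrite -Smax].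
Qed.

Lemma left_independent_rows_leq m n (A : 'M[D]_(m, n)) (S : {set 'I_m}) :
  left_independent_rows A S -> (#|S| <= skew_rank A)%N.
Proof. by move=> /asboolP AS; apply: leq_bigmax_cond. Qed.

Lemma skew_rank_full m n (A : 'M[D]_(m, n)) :
  skew_rank A = m <-> left_injective A.
Proof.
split=> [Am | Ainj].
  have [S AS] := skew_rank_witness A; rewrite Am => Sm c; apply: AS => i.
  suff -> : S = [set: 'I_m] by rewrite inE.
  by apply/eqP; rewrite eqEcard finset.subsetT cardsT card_ord Sm leqnn.
apply/eqP; rewrite eqn_leq; apply/andP; split.
  have [S _ <-] := skew_rank_witness A.
  by rewrite -[X in (_ <= X)%N]card_ord max_card.
rewrite -[X in (X <= _)%N]card_ord -cardsT.
by apply: left_independent_rows_leq => c _; apply: Ainj.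
Qed.

(** A maximal independent set of rows factors the matrix through a free module
    of dimension its rank, and by echelon form contains it as a retract; over a
    skew field these two factorizations characterize the rank. *)
Lemma skew_rank_factor m n (A : 'M[D]_(m, n)) :
  let s := skew_rank A in
  exists (T : 'M[D]_(m, s)) (U : 'M[D]_(s, n)) (E : 'M[D]_(s, m))
    (X : 'M[D]_(n, s)), A = T *m U /\ E *m A *m X = 1%:M.
Proof.
have [S AS Ss] := skew_rank_witness A; rewrite /= -Ss.
(* E selects the rows in S. *)
pose E : 'M[D]_(#|S|, m) := \matrix_(i, j) (enum_val i == j)%:R.
have extend (c : 'rV[D]_#|S|) i : i \notin S -> (c *m E) 0 i = 0.
  move=> iS; rewrite mxE big1 // => k _; rewrite mxE.
  case: eqP => [ki|_]; last by rewrite mulr0.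
  by rewrite -ki enum_valP in iS.
have Einj (c : 'rV[D]_#|S|) : c *m E = 0 -> c = 0.
  move=> cE; apply/rowP => k; have /rowP/(_ (enum_val k)) := cE.
  rewrite !mxE (bigD1 k) //= mxE eqxx mulr1 big1 ?addr0 // => l lk.
  by rewrite mxE (inj_eq enum_val_inj) (negPf lk) mulr0.
have EAinj : left_injective (E *m A).
  move=> c; rewrite mulmxA => cEA; apply: Einj; apply: AS => // i.
  exact: extend.
have [X EAX] := left_injective_right_inverse skewD EAinj.
have coef i : exists t : 'rV[D]_#|S|, row i A = t *m (E *m A).
  have rE j k : E j k = (enum_val j == k)%:R by rewrite mxE.
  have [iS | iS] := boolP (i \in S).
    exists (delta_mx 0 (enum_rank_in iS i)); rewrite mulmxA -rowE.
    rewrite (_ : row _ E = delta_mx 0 i) -?rowE //.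
    by apply/rowP => k; rewrite !mxE eqxx enum_rankK_in // eq_sym.
  (* Maximality: adding row i to S creates a relation, whose coefficient on row
     i is non-zero and can be divided out. *)
  have : ~ left_independent_rows A (i |: S).
    move=> /left_independent_rows_leq; rewrite -Ss cardsU1 iS add1n.
    by rewrite ltnn.
  move=> /existsNP[c /not_implyP[c0 /not_implyP[cA cn0]]].
  have ci0 : c 0 i != 0.
    apply/eqP => ci0; apply: cn0; apply: AS => // j jS.
    have [-> // | ji] := eqVneq j i; by apply: c0; rewrite !inE negb_or ji.
  pose t : 'rV[D]_#|S| := \row_k (- ((c 0 i)^-1 * c 0 (enum_val k))).
  exists t; rewrite mulmxA.
  suff -> : t *m E = delta_mx 0 i - (c 0 i)^-1 *: c.
    by rewrite mulmxBl -rowE -scalemxAl cA scaler0 subr0.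
  apply/rowP => j; rewrite !mxE eqxx /=.
  have [jS | jS] := boolP (j \in S).
    rewrite (bigD1 (enum_rank_in jS j)) //= !mxE enum_rankK_in // eqxx mulr1.
    rewrite big1 ?addr0.
      by rewrite (_ : j == i = false) ?sub0r //; apply: contraNF iS => /eqP<-.
    move=> k kj; rewrite !mxE (_ : _ == j = false) ?mulr0 //.
    apply: contraNF kj => /eqP kj; apply/eqP/enum_val_inj.
    by rewrite enum_rankK_in.
  rewrite big1; last first.
    move=> k _; rewrite !mxE (_ : _ == j = false) ?mulr0 //.
    by apply: contraNF jS => /eqP <-; exact: enum_valP.
  have [-> | ji] := eqVneq j i; first by rewrite mulVr ?subrr // skewD.
  by rewrite (c0 j) ?mulr0 ?subrr // !inE negb_or ji.
have [T TE] := choice coef.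
exists (\matrix_i T i), (E *m A), E, X; split=> //.
by apply/row_matrixP => i; rewrite row_mul rowK TE.
Qed.

End SkewRankTheory.

(** * The rational closure *)

Section RationalClosure.
Variables (K : fieldType) (V : algType K) (B : V -> Prop).
Hypotheses (B0 : B 0) (B1 : B 1) (BZ : forall k x, B x -> B (k *: x)).

Definition entries_in m n (A : 'M[V]_(m, n)) := forall i j, B (A i j).

(** Linear realizations in the sense of Cohn, with N standing for the inverse of
    M. *)
Definition rational (x : V) :=
  exists m (M N : 'M[V]_m) (c : 'rV[V]_m) (b : 'cV[V]_m),
    [/\ entries_in M, entries_in c, entries_in b, inverse_mx M N &
        x%:M = c *m N *m b].

Let entries_in0 m n : entries_in (0 : 'M[V]_(m, n)).
Proof. by move=> i j; rewrite mxE. Qed.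

Let entries_in_scalar n x : B x -> entries_in (x%:M : 'M[V]_n).
Proof. by move=> xB i j; rewrite mxE; case: (i == j). Qed.

Let entries_inZ m n k (A : 'M[V]_(m, n)) :
  entries_in A -> entries_in (k%:A *: A).
Proof. by move=> AB i j; rewrite mxE mulr_algl; apply: BZ. Qed.

Let entries_inN m n (A : 'M[V]_(m, n)) : entries_in A -> entries_in (- A).
Proof. by move=> /(entries_inZ (-1)); rewrite scaleN1r scaleN1r. Qed.

Let entries_in_row m n1 n2 (A : 'M[V]_(m, n1)) (A' : 'M[V]_(m, n2)) :
  entries_in A -> entries_in A' -> entries_in (row_mx A A').
Proof. by move=> AB A'B i j; rewrite mxE; case: splitP. Qed.

Let entries_in_col m1 m2 n (A : 'M[V]_(m1, n)) (A' : 'M[V]_(m2, n)) :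
  entries_in A -> entries_in A' -> entries_in (col_mx A A').
Proof. by move=> AB A'B i j; rewrite mxE; case: splitP. Qed.

Lemma entries_in_block m1 m2 n1 n2 (A1 : 'M[V]_(m1, n1)) (A2 : 'M[V]_(m1, n2))
    (A3 : 'M[V]_(m2, n1)) (A4 : 'M[V]_(m2, n2)) :
  entries_in A1 -> entries_in A2 -> entries_in A3 -> entries_in A4 ->
  entries_in (block_mx A1 A2 A3 A4).
Proof. by move=> *; apply: entries_in_col; apply: entries_in_row. Qed.

Lemma rational_gen x : B x -> rational x.
Proof.
move=> xB; exists 1, 1%:M, 1%:M, x%:M, 1%:M.
split; try exact: entries_in_scalar; first by split; rewrite mulmx1.
by rewrite !mulmx1.
Qed.

Lemma rationalD x y : rational x -> rational y -> rational (x + y).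
Proof.
move=> [m [M [N [c [b [MB cB bB [MN NM] xE]]]]]].
move=> [m' [M' [N' [c' [b' [MB' cB' bB' [MN' NM'] yE]]]]]].
exists (m + m')%N, (block_mx M 0 0 M'), (block_mx N 0 0 N'), (row_mx c c'),
  (col_mx b b'); split.
- exact: entries_in_block.
- exact: entries_in_row.
- exact: entries_in_col.
- split; rewrite mulmx_block ?MN ?NM ?MN' ?NM' ?(mulmx0, mul0mx, addr0, add0r);
  by rewrite -scalar_mx_block.
rewrite mul_row_block mul_row_col !mulmx0 addr0 add0r raddfD.
by congr (_ + _).
Qed.

Lemma rationalZ k x : rational x -> rational (k *: x).
Proof.
move=> [m [M [N [c [b [MB cB bB MNK xE]]]]]].
exists m, M, N, (k%:A *: c), b; split=> //; first exact: entries_inZ.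
by rewrite -!scalemxAl -xE scale_scalar_mx mulr_algl.
Qed.

(** The upper right block of the inverse of the block triangular matrix with
    diagonal M, 1, M' and superdiagonal - b, - c' is N b c' N'.  The middle
    block keeps b and c' apart, since the entries of b c' may fall outside B. *)
Lemma rationalM x y : rational x -> rational y -> rational (x * y).
Proof.
move=> [m [M [N [c [b [MB cB bB MNK xE]]]]]].
move=> [m' [M' [N' [c' [b' [MB' cB' bB' MNK' yE]]]]]].
have oneK : inverse_mx (1%:M : 'M[V]_1) 1%:M by split; rewrite mulmx1.
have M1K := inverse_block_triangular (- b) MNK oneK.
have M2K := inverse_block_triangular
  (col_mx (0 : 'M[V]_(m, m')) (- c')) M1K MNK'.
set N1 := block_mx N _ _ _ in M1K M2K.
exists ((m + 1) + m')%N, (block_mx (block_mx M (- b) 0 1%:M)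
  (col_mx (0 : 'M[V]_(m, m')) (- c')) 0 M').
exists (block_mx N1 (- (N1 *m col_mx 0 (- c') *m N')) 0 N').
exists (row_mx (row_mx c 0) 0), (col_mx 0 b'); split.
- apply: entries_in_block => //; last exact: entries_in_col (entries_inN _).
  by apply: entries_in_block => //; [exact: entries_inN |
     exact: entries_in_scalar].
- by apply: entries_in_row => //; apply: entries_in_row.
- exact: entries_in_col.
- exact: M2K.
rewrite mul_row_block mul_row_col !(mulmx0, mul0mx, addr0, add0r).
rewrite mulmxN !mulmxA mul_row_block !(mulmx0, mul0mx, mulmx1, addr0, add0r).
rewrite mul_row_col mulmx0 add0r !(mulmxN, mulNmx) !opprK.
by rewrite scalar_mxM xE yE !mulmxA.
Qed.

Definition bordered m (M : 'M[V]_m) (c : 'rV[V]_m) (b : 'cV[V]_m) :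
  'M[V]_(m + 1) := block_mx M b c 0.

Lemma bordered_entries m (M : 'M[V]_m) (c : 'rV[V]_m) (b : 'cV[V]_m) :
  entries_in M -> entries_in c -> entries_in b -> entries_in (bordered M c b).
Proof. by move=> *; apply: entries_in_block. Qed.

(** The Schur complement of M in the bordered matrix is - c N b, and its inverse
    is the lower right corner of the inverse of the bordered matrix. *)
Lemma bordered_rational_inverse m (M N : 'M[V]_m) (c : 'rV[V]_m) (b : 'cV[V]_m)
    (T : 'M[V]_(m + 1)) x :
  entries_in M -> entries_in c -> entries_in b -> inverse_mx M N ->
  x%:M = c *m N *m b -> inverse_mx (bordered M c b) T ->
  exists y, [/\ rational y, x * y = 1 & y * x = 1].
Proof.
move=> MB cB bB [MN NM] xE TK.
exists (- (drsubmx T 0 0)); have [BT TB] := TK.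
set d := drsubmx T 0 0.
have dE : drsubmx T = d%:M by rewrite [LHS]mx11_scalar.
move: BT; rewrite -[T]submxK /bordered mulmx_block scalar_mx_block dE.
case/eq_block_mx => _ e1 _; rewrite mul0mx addr0 => e2.
move: TB; rewrite -[T]submxK /bordered mulmx_block scalar_mx_block dE.
case/eq_block_mx => _ _ f1; rewrite mulmx0 addr0 => f2.
have scalarN (u : V) : (- u)%:M = - u%:M :> 'M[V]_1.
  by apply/matrixP => i j; rewrite !ord1 !mxE.
have inj1 (u v : V) : u%:M = v%:M :> 'M[V]_1 -> u = v.
  by move=> /matrixP/(_ 0 0); rewrite !mxE eqxx.
split; last 2 first.
- apply: inj1; rewrite mulrN scalarN scalar_mxM xE -!mulmxA.
  have /(congr1 (mulmx N)) /= := e1.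
  rewrite mulmxDr mulmx0 (mulmxA N M) NM mul1mx.
  by move=> /(canRL (addrK _)); rewrite sub0r => uE; rewrite -e2 uE mulmxN.
- apply: inj1; rewrite mulNr scalarN scalar_mxM xE !mulmxA.
  have /(congr1 (mulmx^~ N)) /= := f1.
  rewrite mulmxDl mul0mx -(mulmxA _ M) MN mulmx1.
  by move=> /(canRL (addrK _)); rewrite sub0r => uE; rewrite -f2 uE mulNmx.
exists (m + 1)%N, (bordered M c b), T, (row_mx 0 (- 1%:M)), (col_mx 0 1%:M).
split=> //; first exact: bordered_entries.
- by apply: entries_in_row => //; apply/entries_inN/entries_in_scalar.
- by apply: entries_in_col => //; apply: entries_in_scalar.
rewrite -[T]submxK mul_row_block mul_row_col !(mulmx0, mul0mx, addr0, add0r).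
by rewrite mulmx1 mulNmx mul1mx dE scalarN.
Qed.

(** What an integer-valued rank implies: the rank of the bordered matrix is
    that of M plus that of c N b, hence it is the rank of M, and then c N b is
    zero, or it is full. *)
Definition bordered_dichotomy :=
  forall m (M N : 'M[V]_m) (c : 'rV[V]_m) (b : 'cV[V]_m),
    entries_in M -> entries_in c -> entries_in b -> inverse_mx M N ->
    c *m N *m b = 0 \/ exists T, inverse_mx (bordered M c b) T.

Lemma rational_inverse x : bordered_dichotomy -> rational x -> x != 0 ->
  exists y, [/\ rational y, x * y = 1 & y * x = 1].
Proof.
move=> Bdich [m [M [N [c [b [MB cB bB MNK xE]]]]]] x0.
have [cNb0 | [T TK]] := Bdich _ _ _ _ _ MB cB bB MNK.
  by move: x0 xE; rewrite cNb0 => /eqP x0 /matrixP/(_ 0 0); rewrite !mxE eqxx.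
exact: (bordered_rational_inverse MB cB bB MNK xE TK).
Qed.

Definition rational_pred : {pred V} := [pred x | `[< rational x >]].

Lemma rational_predP x : reflect (rational x) (x \in rational_pred).
Proof. exact: asboolP. Qed.

Lemma rational_subalg : GRing.subalg_closed rational_pred.
Proof.
split=> [|k x y /rational_predP xr /rational_predP yr|
         x y /rational_predP xr /rational_predP yr]; apply/rational_predP.
- exact: rational_gen.
- by apply: rationalD => //; apply: rationalZ.
- exact: rationalM.
Qed.

HB.instance Definition _ :=
  GRing.isSubalgClosed.Build K V rational_pred rational_subalg.

Record rational_closure :=
  RationalClosure { rational_val : V; _ : rational_val \in rational_pred }.

HB.instance Definition _ := [isSub for rational_val].
HB.instance Definition _ := [Choice of rational_closure by <:].
HB.instance Definition _ := [SubChoice_isSubAlgebra of rational_closure by <:].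

Lemma rational_closure_skew_field : bordered_dichotomy ->
  exists (D : unitAlgType K) (i : {lrmorphism D -> V}),
    [/\ skew_field D, injective i & forall x, rational x <-> exists d, x = i d].
Proof.
move=> Bdich.
have inv_ex (x : rational_closure) :
    exists y, if x == 0 then y = x else x * y = 1 /\ y * x = 1.
  have [-> | x0] := eqVneq x 0; first by exists 0.
  have xr : rational (val x) by exact/rational_predP/(valP x).
  have vx0 : val x != 0.
    by rewrite -[0]/(val (0 : rational_closure)) (inj_eq val_inj).
  have [y [yr xy yx]] := rational_inverse Bdich xr vx0.
  have yP : y \in rational_pred by apply/rational_predP.
  by exists (Sub y yP); split; apply: val_inj.
have [inv invP] := choice inv_ex.
pose unit := [pred x : rational_closure | x != 0].
have mulVx : {in unit, left_inverse 1 inv *%R}.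
  by move=> x; rewrite inE => /negPf x0; have := invP x; rewrite x0 => -[].
have mulxV : {in unit, right_inverse 1 inv *%R}.
  by move=> x; rewrite inE => /negPf x0; have := invP x; rewrite x0 => -[].
have unitP (x y : rational_closure) : y * x = 1 /\ x * y = 1 -> unit x.
  move=> [yx _]; apply/eqP => x0; have /eqP := yx.
  by rewrite x0 mulr0 eq_sym oner_eq0.
have inv_out : {in [predC unit], inv =1 id}.
  by move=> x; rewrite !inE negbK => x0; have := invP x; rewrite x0.
pose mixin := GRing.NzRing_hasMulInverse.Build rational_closure
  mulVx mulxV unitP inv_out.
pose D : unitAlgType K := HB.pack rational_closure mixin.
have valL : linear (rational_val : D -> V).
  exact: (linearP (val : {linear rational_closure -> V})).
have valM : monoid_morphism (rational_val : D -> V).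
  pose f : {rmorphism rational_closure -> V} := val.
  by split; [exact: (rmorph1 f) | exact: (rmorphM f)].
pose i : {lrmorphism D -> V} := HB.pack (rational_val : D -> V)
  (GRing.isLinear.Build K D V *:%R (rational_val : D -> V) valL)
  (GRing.isMonoidMorphism.Build D V (rational_val : D -> V) valM).
exists D, i; split.
- by move=> x.
- exact: val_inj.
move=> x; split=> [xr | [d ->]]; last exact/rational_predP/(valP d).
have xP : x \in rational_pred by apply/rational_predP.
by exists (Sub x xP).
Qed.

End RationalClosure.

(** * Linear extensions of maps on a group *)

Section LinearExtension.
Variables (K : fieldType) (G : groupType) (V : lmodType K) (f : G -> V).

Lemma linear_extensionZ k a :
  linear_extension f (k *: a) = k *: linear_extension f a.
Proof.
rewrite /linear_extension scaler_sumr.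
have [-> | k0] := eqVneq k 0.
  rewrite scale0r msupp0 big_seq_fset0 big1 // => g _.
  by rewrite scale0r.
rewrite msuppZ (negPf k0); apply: eq_bigr => g _.
by rewrite mcoeffZ scalerA.
Qed.

Lemma linear_extension0 : linear_extension f 0 = 0.
Proof. by rewrite -(scale0r 0) linear_extensionZ scale0r. Qed.

Lemma linear_extensionU g : linear_extension f (mkmalgU g 1) = f g.
Proof.
rewrite /linear_extension msuppU oner_eq0 big_seq_fset1.
by rewrite mcoeffU eqxx scale1r.
Qed.

Lemma linear_extension_comp (W : lmodType K) (h : V -> W) a :
  h 0 = 0 -> {morph h : x y / x + y} -> (forall k, {morph h : x / k *: x}) ->
  linear_extension (fun g => h (f g)) a = h (linear_extension f a).
Proof.
move=> h0 hD hZ; rewrite /linear_extension (big_morph h hD h0).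
by apply: eq_bigr => g _; rewrite hZ.
Qed.

Definition in_span (x : V) := exists a, x = linear_extension f a.

Lemma in_span0 : in_span 0.
Proof. by exists 0; rewrite linear_extension0. Qed.

Lemma in_spanZ k x : in_span x -> in_span (k *: x).
Proof. by move=> [a ->]; exists (k *: a); rewrite linear_extensionZ. Qed.

Lemma in_span_gen g : in_span (f g).
Proof. by exists (mkmalgU g 1); rewrite linear_extensionU. Qed.

Lemma in_span_mx m n (A : 'M[V]_(m, n)) : (forall i j, in_span (A i j)) ->
  exists A' : 'M[group_algebra K G]_(m, n), A = map_mx (linear_extension f) A'.
Proof.
move=> /(_ _)/(_ _)/cid AB; exists (\matrix_(i, j) sval (AB i j)).
by apply/matrixP => i j; rewrite !mxE; case: (AB i j).
Qed.

End LinearExtension.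

(** * Sequences of matrices and their relative rank *)

Section MatrixSequences.
Variables (K : fieldType) (d : nat -> nat).

Definition mxseq := forall k, 'M[K]_(d k).

HB.instance Definition _ := gen_eqMixin mxseq.
HB.instance Definition _ := gen_choiceMixin mxseq.

Implicit Types x y z : mxseq.

Let mxseq0 : mxseq := fun k => 0.
Let mxseq1 : mxseq := fun k => 1%:M.
Let mxseq_opp x : mxseq := fun k => - x k.
Let mxseq_add x y : mxseq := fun k => x k + y k.
Let mxseq_mul x y : mxseq := fun k => x k *m y k.
Let mxseq_scale (a : K) x : mxseq := fun k => a *: x k.

Let mxseqP x y : (forall k, x k = y k) -> x = y.
Proof. exact: functional_extensionality_dep. Qed.

Let mxseq_addA : associative mxseq_add.
Proof. by move=> x y z; apply: mxseqP => k; exact: addrA. Qed.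
Let mxseq_addC : commutative mxseq_add.
Proof. by move=> x y; apply: mxseqP => k; exact: addrC. Qed.
Let mxseq_add0 : left_id mxseq0 mxseq_add.
Proof. by move=> x; apply: mxseqP => k; exact: add0r. Qed.
Let mxseq_addN : left_inverse mxseq0 mxseq_opp mxseq_add.
Proof. by move=> x; apply: mxseqP => k; exact: addNr. Qed.

HB.instance Definition _ :=
  GRing.isZmodule.Build mxseq mxseq_addA mxseq_addC mxseq_add0 mxseq_addN.

Let mxseq_mulA : associative mxseq_mul.
Proof. by move=> x y z; apply: mxseqP => k; exact: mulmxA. Qed.
Let mxseq_mul1l : left_id mxseq1 mxseq_mul.
Proof. by move=> x; apply: mxseqP => k; exact: mul1mx. Qed.
Let mxseq_mul1r : right_id mxseq1 mxseq_mul.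
Proof. by move=> x; apply: mxseqP => k; exact: mulmx1. Qed.
Let mxseq_mulDl : left_distributive mxseq_mul +%R.
Proof. by move=> x y z; apply: mxseqP => k; exact: mulmxDl. Qed.
Let mxseq_mulDr : right_distributive mxseq_mul +%R.
Proof. by move=> x y z; apply: mxseqP => k; exact: mulmxDr. Qed.

HB.instance Definition _ := GRing.Zmodule_isPzRing.Build mxseq
  mxseq_mulA mxseq_mul1l mxseq_mul1r mxseq_mulDl mxseq_mulDr.

Let mxseq_scaleA a b x :
  mxseq_scale a (mxseq_scale b x) = mxseq_scale (a * b) x.
Proof. by apply: mxseqP => k; exact: scalerA. Qed.
Let mxseq_scale1 : left_id 1 mxseq_scale.
Proof. by move=> x; apply: mxseqP => k; exact: scale1r. Qed.
Let mxseq_scaleDr : right_distributive mxseq_scale +%R.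
Proof. by move=> a x y; apply: mxseqP => k; exact: scalerDr. Qed.
Let mxseq_scaleDl x : {morph mxseq_scale^~ x : a b / a + b}.
Proof. by move=> a b; apply: mxseqP => k; exact: scalerDl. Qed.

HB.instance Definition _ := GRing.Zmodule_isLmodule.Build K mxseq
  mxseq_scaleA mxseq_scale1 mxseq_scaleDr mxseq_scaleDl.

Lemma mxseq_scaleAl (a : K) x y : a *: (x * y) = (a *: x) * y.
Proof. by apply: mxseqP => k; exact: scalemxAl. Qed.

Lemma mxseq_scaleAr (a : K) x y : a *: (x * y) = x * (a *: y).
Proof. by apply: mxseqP => k; exact: scalemxAr. Qed.

Lemma mxseq_sumE (I : Type) (r : seq I) (P : pred I) (F : I -> mxseq) k :
  (\sum_(i <- r | P i) F i) k = \sum_(i <- r | P i) F i k.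
Proof. exact: (big_morph (fun x : mxseq => x k)). Qed.

Definition flatten_mx m n (X : 'M[mxseq]_(m, n)) k :
  'M[K]_(\sum_(i < m) d k, \sum_(j < n) d k) := \mxblock_(i, j) X i j k.

Lemma flatten_mxM m n p (X : 'M[mxseq]_(m, n)) (Y : 'M[mxseq]_(n, p)) k :
  flatten_mx (X *m Y) k = flatten_mx X k *m flatten_mx Y k.
Proof.
rewrite /flatten_mx mul_mxblock; apply: eq_mxblock => i j.
by rewrite mxE mxseq_sumE.
Qed.

Lemma flatten_mxD m n (X Y : 'M[mxseq]_(m, n)) k :
  flatten_mx (X + Y) k = flatten_mx X k + flatten_mx Y k.
Proof.
by rewrite /flatten_mx -mxblockD; apply: eq_mxblock => i j; rewrite mxE.
Qed.

Lemma flatten_mxN m n (X : 'M[mxseq]_(m, n)) k :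
  flatten_mx (- X) k = - flatten_mx X k.
Proof.
by rewrite /flatten_mx -mxblockN; apply: eq_mxblock => i j; rewrite mxE.
Qed.

Lemma flatten_mx_diag m (x : 'rV[mxseq]_m) k :
  flatten_mx (diag_mx x) k = \mxdiag_(i < m) x 0 i k.
Proof.
apply: eq_mxblock => i j; rewrite mxE conform_mx_id.
by case: eqVneq => [->|].
Qed.

Lemma flatten_mx1 m k : flatten_mx (1%:M : 'M[mxseq]_m) k = 1%:M.
Proof.
rewrite -diag_const_mx flatten_mx_diag -mxdiagZ; apply: eq_mxdiag => i.
by rewrite mxE.
Qed.

Definition unflatten_mx m n
    (A : forall k, 'M[K]_(\sum_(i < m) d k, \sum_(j < n) d k)) :
  'M[mxseq]_(m, n) := \matrix_(i, j) fun k => submxblock (A k) i j.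

Lemma unflatten_mxK m n
    (A : forall k, 'M[K]_(\sum_(i < m) d k, \sum_(j < n) d k)) k :
  flatten_mx (unflatten_mx A) k = A k.
Proof.
by rewrite -[RHS]submxblockK; apply: eq_mxblock => i j; rewrite mxE.
Qed.

End MatrixSequences.

Section RelativeRank.
Variables (R : realType) (K : fieldType) (d : nat -> nat).
Hypothesis d_gt0 : forall k, (0 < d k)%N.
Notation P := (mxseq K d).

Definition rel_rank m n (X : 'M[P]_(m, n)) k : R :=
  (\rank (flatten_mx X k))%:R / (d k)%:R.

Definition entry_rank (x : P) k : R := (\rank (x k))%:R / (d k)%:R.

Lemma rel_rankMl m n p (X : 'M[P]_(m, n)) (Y : 'M[P]_(n, p)) k :
  rel_rank (X *m Y) k <= rel_rank X k.
Proof.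
by rewrite /rel_rank ler_wpM2r ?invr_ge0 // ler_nat flatten_mxM mxrankM_maxl.
Qed.

Lemma rel_rankMr m n p (X : 'M[P]_(m, n)) (Y : 'M[P]_(n, p)) k :
  rel_rank (X *m Y) k <= rel_rank Y k.
Proof.
by rewrite /rel_rank ler_wpM2r ?invr_ge0 // ler_nat flatten_mxM mxrankM_maxr.
Qed.

Lemma rel_rankD m n (X Y : 'M[P]_(m, n)) k :
  rel_rank (X + Y) k <= rel_rank X k + rel_rank Y k.
Proof.
rewrite /rel_rank -mulrDl ler_wpM2r ?invr_ge0 // -natrD ler_nat flatten_mxD.
exact: mxrank_add.
Qed.

Lemma rel_rankN m n (X : 'M[P]_(m, n)) k : rel_rank (- X) k = rel_rank X k.
Proof. by rewrite /rel_rank flatten_mxN mxrank_opp. Qed.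

Lemma rel_rank0 m n k : rel_rank (0 : 'M[P]_(m, n)) k = 0.
Proof.
rewrite /rel_rank (_ : flatten_mx _ k = 0) ?mxrank0 ?mul0r //.
by rewrite /flatten_mx -[RHS]mxblock0; apply: eq_mxblock => i j; rewrite mxE.
Qed.

Lemma rel_rank_ge0 m n (X : 'M[P]_(m, n)) k : 0 <= rel_rank X k.
Proof. by rewrite /rel_rank divr_ge0. Qed.

Lemma rel_rank_diag m (x : 'rV[P]_m) k :
  rel_rank (diag_mx x) k = \sum_i entry_rank (x 0 i) k.
Proof. by rewrite /rel_rank flatten_mx_diag rank_mxdiag natr_sum mulr_suml. Qed.

Lemma rel_rank_scalar (x : P) k :
  rel_rank (x%:M : 'M[P]_1) k = entry_rank x k.
Proof. by rewrite -diag_const_mx rel_rank_diag big_ord1 mxE. Qed.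

Lemma rel_rank1 m k : rel_rank (1%:M : 'M[P]_m) k = m%:R.
Proof.
have dk0 : (d k)%:R != 0 :> R by rewrite pnatr_eq0 -lt0n.
rewrite /rel_rank flatten_mx1 mxrank1 sum_nat_const card_ord natrM mulfK //.
Qed.

Lemma rel_rank_max m n (X : 'M[P]_(m, n)) k : rel_rank X k <= m%:R.
Proof. by rewrite -(rel_rank1 m k) -[X]mul1mx; apply: rel_rankMl. Qed.

Lemma rel_rank_entry m n (X : 'M[P]_(m, n)) i j k :
  entry_rank (X i j) k <= rel_rank X k.
Proof.
rewrite -rel_rank_scalar.
have -> : (X i j)%:M = delta_mx 0 i *m X *m delta_mx j 0 :> 'M[P]_1.
  by rewrite -rowE -colE; apply/matrixP => u v; rewrite !ord1 !mxE.
exact: le_trans (rel_rankMl _ _ _) (rel_rankMr _ _ _).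
Qed.

(** A matrix is the sum of its entries, each placed by a column and a row. *)
Lemma rel_rank_le_entries m n (X : 'M[P]_(m, n)) k :
  rel_rank X k <= \sum_i \sum_j entry_rank (X i j) k.
Proof.
have XE : X = \sum_i \sum_j
    (delta_mx i 0 *m (X i j)%:M *m (delta_mx 0 j : 'rV[P]_n)).
  rewrite [LHS]matrix_sum_delta; apply: eq_bigr => i _; apply: eq_bigr => j _.
  apply/matrixP => u v; rewrite !mxE big_ord1 !mxE big_ord1 !mxE eqxx !andbT /=.
  by case: (u == i); case: (v == j); rewrite ?(mulr0, mulr1, mul0r, mul1r).
have sumle (I : finType) (F : I -> 'M[P]_(m, n)) :
    rel_rank (\sum_i F i) k <= \sum_i rel_rank (F i) k.
  apply: (big_ind2 (fun (Y : 'M[P]_(m, n)) r => rel_rank Y k <= r)) => //.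
    by rewrite rel_rank0.
  move=> Y r Z s Yr Zs; apply: le_trans (rel_rankD _ _ _) _.
  exact: lerD.
rewrite {1}XE; apply: le_trans (sumle _ _) _; apply: ler_sum => i _.
apply: le_trans (sumle _ _) _; apply: ler_sum => j _.
rewrite -rel_rank_scalar; exact: le_trans (rel_rankMl _ _ _) (rel_rankMr _ _ _).
Qed.

End RelativeRank.

(** * The algebra of sequences modulo an ideal *)

Section SequenceQuotient.
Local Open Scope quotient_scope.
Variables (K : fieldType) (d : nat -> nat).
Notation P := (mxseq K d).
Variable I : zmodClosed P.
Hypotheses (idealMl : forall x y : P, y \in I -> x * y \in I)
  (idealMr : forall x y : P, x \in I -> x * y \in I)
  (idealZ : forall (a : K) (x : P), x \in I -> a *: x \in I)
  (ideal1 : 1 \notin I).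

Definition ideal_quotient := Quotient.quot I.
Notation Q := ideal_quotient.
HB.instance Definition _ := GRing.Zmodule.on Q.

Let pr (x : P) : Q := \pi_(Quotient.quot I) x.

Let prE x y : (pr x = pr y) <-> (x - y \in I).
Proof. by rewrite Quotient.idealrBE; split=> [/eqP|/eqP]. Qed.

Let pr_repr (u : Q) : pr (repr (u : Quotient.quot I)) = u.
Proof. exact: reprK. Qed.

Let prD x y : pr (x + y) = pr x + pr y.
Proof. exact: raddfD. Qed.

Let pr0 : pr 0 = 0.
Proof. exact: raddf0. Qed.

Let quot_ind (p : Q -> Prop) : (forall x, p (pr x)) -> forall u, p u.
Proof. by move=> px u; rewrite -(pr_repr u). Qed.

Let qmul (u v : Q) : Q :=
  pr (repr (u : Quotient.quot I) * repr (v : Quotient.quot I)).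
Let qscale (a : K) (u : Q) : Q := pr (a *: repr (u : Quotient.quot I)).

Let prM x y : pr (x * y) = qmul (pr x) (pr y).
Proof.
set x' := repr (pr x : Quotient.quot I).
set y' := repr (pr y : Quotient.quot I).
have xI : x - x' \in I by apply/prE; rewrite pr_repr.
have yI : y - y' \in I by apply/prE; rewrite pr_repr.
apply/prE; rewrite (_ : _ - _ = (x - x') * y + x' * (y - y')).
  by apply: rpredD; [exact: idealMr | exact: idealMl].
by rewrite mulrBl mulrBr addrA subrK.
Qed.

Let prZ a x : pr (a *: x) = qscale a (pr x).
Proof.
apply/prE; rewrite -scalerBr idealZ //; apply/prE.
by rewrite pr_repr.
Qed.

Let qmulA : associative qmul.
Proof.
by elim/quot_ind=> x; elim/quot_ind=> y; elim/quot_ind=> z;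
  rewrite -!prM mulrA.
Qed.
Let qmul1l : left_id (pr 1) qmul.
Proof. by elim/quot_ind=> x; rewrite -!prM mul1r. Qed.
Let qmul1r : right_id (pr 1) qmul.
Proof. by elim/quot_ind=> x; rewrite -!prM mulr1. Qed.
Let qmulDl : left_distributive qmul +%R.
Proof.
by elim/quot_ind=> x; elim/quot_ind=> y; elim/quot_ind=> z;
  rewrite -prD -!prM mulrDl prD.
Qed.
Let qmulDr : right_distributive qmul +%R.
Proof.
by elim/quot_ind=> x; elim/quot_ind=> y; elim/quot_ind=> z;
  rewrite -prD -!prM mulrDr prD.
Qed.
Let qone_neq0 : pr 1 != 0.
Proof.
apply/eqP; rewrite -pr0 => /prE.
by rewrite subr0 (negPf ideal1).
Qed.

HB.instance Definition _ := GRing.Zmodule_isNzRing.Build Q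
  qmulA qmul1l qmul1r qmulDl qmulDr qone_neq0.

Let qscaleA a b u : qscale a (qscale b u) = qscale (a * b) u.
Proof. by elim/quot_ind: u => x; rewrite -!prZ scalerA. Qed.
Let qscale1 : left_id 1 qscale.
Proof. by elim/quot_ind=> x; rewrite -prZ scale1r. Qed.
Let qscaleDr : right_distributive qscale +%R.
Proof.
by move=> a; elim/quot_ind=> x; elim/quot_ind=> y;
  rewrite -prD -!prZ scalerDr prD.
Qed.
Let qscaleDl u : {morph qscale^~ u : a b / a + b}.
Proof. by elim/quot_ind: u => x a b; rewrite -!prZ scalerDl prD. Qed.

HB.instance Definition _ := GRing.Zmodule_isLmodule.Build K Q
  qscaleA qscale1 qscaleDr qscaleDl.

Let qscaleAl (a : K) (u v : Q) : a *: (u * v) = (a *: u) * v.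
Proof.
by elim/quot_ind: u => x; elim/quot_ind: v => y;
  rewrite -[LHS]/(qscale _ (qmul _ _)) -[RHS]/(qmul (qscale _ _) _)
    -prM -!prZ -prM mxseq_scaleAl.
Qed.
Let qscaleAr (a : K) (u v : Q) : a *: (u * v) = u * (a *: v).
Proof.
by elim/quot_ind: u => x; elim/quot_ind: v => y;
  rewrite -[LHS]/(qscale _ (qmul _ _)) -[RHS]/(qmul _ (qscale _ _))
    -prM -!prZ -prM mxseq_scaleAr.
Qed.

HB.instance Definition _ := GRing.Lmodule_isLalgebra.Build K Q qscaleAl.
HB.instance Definition _ := GRing.Lalgebra_isAlgebra.Build K Q qscaleAr.

Lemma mxseq_quotient : exists (V : algType K) (q : {rmorphism P -> V}),
  [/\ forall a x, q (a *: x) = a *: q x, forall v, exists x, q x = v &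
      forall x, q x = 0 <-> x \in I].
Proof.
have prM' : monoid_morphism pr by split=> // x y; exact: prM.
have prB : zmod_morphism pr by exact: raddfB.
pose q : {rmorphism P -> Q} := HB.pack pr
  (GRing.isZmodMorphism.Build P Q pr prB)
  (GRing.isMonoidMorphism.Build P Q pr prM').
exists Q, q; split=> [a x | v | x]; first exact: prZ.
  by exists (repr (v : Quotient.quot I)); apply: pr_repr.
by have := prE x 0; rewrite subr0 pr0.
Qed.

End SequenceQuotient.

(** * Asymptotic rank *)

Section AsymptoticRank.
Variables (R : realType) (K : fieldType) (d : nat -> nat).
Hypothesis d_gt0 : forall k, (0 < d k)%N.
Notation P := (mxseq K d).
Local Open Scope classical_set_scope.

Definition negligible : {pred P} :=
  [pred x | `[< entry_rank R x @ \oo --> (0 : R) >]].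

Lemma negligibleP x :
  reflect (entry_rank R x @ \oo --> (0 : R)) (x \in negligible).
Proof. exact: asboolP. Qed.

Lemma dominated_cvg0 (u v : R ^nat) :
  (forall k, 0 <= u k <= v k) -> v @ \oo --> (0 : R) -> u @ \oo --> (0 : R).
Proof.
move=> uv v0; apply: (squeeze_cvgr (f := cst 0) (h := v)) => //.
  by near=> k; exact: uv.
exact: cvg_cst.
Unshelve. all: by end_near. Qed.

Lemma sum_cvg0 (I : finType) (u : I -> R ^nat) :
  (forall i, u i @ \oo --> (0 : R)) ->
  (fun k => \sum_i u i k) @ \oo --> (0 : R).
Proof.
move=> u0; rewrite [X in X @ _](_ : _ = \sum_i u i); last first.
  by apply/funext => k; rewrite fct_sumE.
apply: (big_ind (fun v : R ^nat => v @ \oo --> (0 : R))) => //.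
  exact: cvg_cst.
by move=> v w v0 w0; rewrite -[0](addr0 (0 : R)); apply: cvgD.
Qed.

Lemma entry_rank_ge0 (x : P) k : 0 <= entry_rank R x k.
Proof. by rewrite /entry_rank divr_ge0. Qed.

Lemma negligible_le (x y : P) :
  (forall k, (\rank (x k) <= \rank (y k))%N) -> y \in negligible ->
  x \in negligible.
Proof.
move=> xy /negligibleP y0; apply/negligibleP; apply: dominated_cvg0 y0 => k.
by rewrite entry_rank_ge0 /entry_rank ler_wpM2r ?invr_ge0 // ler_nat.
Qed.

Lemma negligible_zmod : zmod_closed negligible.
Proof.
split=> [|x y /negligibleP x0 /negligibleP y0]; apply/negligibleP.
  rewrite (_ : entry_rank _ _ = cst 0); first exact: cvg_cst.
  by apply/funext => k; rewrite /entry_rank mxrank0 mul0r.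
have xy0 : entry_rank R x \+ entry_rank R y @ \oo --> (0 : R).
  by rewrite -[0]addr0; apply: cvgD.
apply: dominated_cvg0 xy0 => k; rewrite entry_rank_ge0 /entry_rank /= -mulrDl.
rewrite ler_wpM2r ?invr_ge0 // -natrD ler_nat.
rewrite -[X in (_ <= _ + X)%N]mxrank_opp; exact: mxrank_add.
Qed.

HB.instance Definition _ :=
  GRing.isZmodClosed.Build P negligible negligible_zmod.

(** The quotient contains 1 <> 0 because the identity has relative rank 1. *)
Lemma rank_quotient : exists (V : algType K) (q : {rmorphism P -> V}),
  [/\ forall a x, q (a *: x) = a *: q x, forall v, exists x, q x = v &
      forall x, q x = 0 <-> x \in negligible].
Proof.
apply: mxseq_quotient => [x y yI | x y xI | a x xI | ].
- by apply: negligible_le yI => k; apply: mxrankM_maxr.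
- by apply: negligible_le xI => k; apply: mxrankM_maxl.
- by apply: negligible_le xI => k; apply: mxrank_scale.
apply/negligibleP => /cvg_lim lim0.
suff /eqP : 1 = 0 :> R by rewrite oner_eq0.
rewrite -lim0 //; apply/esym/lim_near_cst => //; near=> k.
have dk0 : (d k)%:R != 0 :> R by rewrite pnatr_eq0 -lt0n.
by rewrite /entry_rank mxrank1 divff.
Unshelve. all: by end_near. Qed.

Definition asymp_le (u v : R ^nat) :=
  exists2 z : R ^nat, z @ \oo --> (0 : R) & forall k, u k <= v k + z k.

Lemma asymp_le_lim (u v : R ^nat) (a b : R) :
  asymp_le u v -> u @ \oo --> a -> v @ \oo --> b -> a <= b.
Proof.
move=> [z z0 uvz] ua vb; have vzb : v \+ z @ \oo --> b.
  by rewrite -[b]addr0; apply: cvgD.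
rewrite -(cvg_lim _ ua) // -(cvg_lim _ vzb) //; apply: ler_lim.
- by apply/cvg_ex; exists a.
- by apply/cvg_ex; exists b.
by near=> k; exact: uvz.
Unshelve. all: by end_near. Qed.

Variables (V : algType K) (q : {rmorphism P -> V}).
Hypotheses (q_surj : forall v, exists x, q x = v)
  (q_ker : forall x, q x = 0 <-> x \in negligible).

Lemma lift_mx m n (A : 'M[V]_(m, n)) :
  exists A' : 'M[P]_(m, n), map_mx q A' = A.
Proof.
have [r rE] := choice q_surj.
by exists (map_mx r A); apply/matrixP => i j; rewrite !mxE rE.
Qed.

Lemma rel_rank_cvg0 m n (X : 'M[P]_(m, n)) :
  map_mx q X = 0 -> rel_rank R X @ \oo --> (0 : R).
Proof.
move=> qX; have sum0 : (fun k => \sum_i \sum_j entry_rank R (X i j) k) @ \oo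
    --> (0 : R).
  apply: sum_cvg0 => i; apply: sum_cvg0 => j.
  by apply/negligibleP/q_ker; have /matrixP/(_ i j) := qX; rewrite !mxE.
apply: dominated_cvg0 sum0 => k; rewrite rel_rank_ge0 //=.
exact: rel_rank_le_entries.
Qed.

Lemma map_mx_eq0 m n (X : 'M[P]_(m, n)) :
  rel_rank R X @ \oo --> (0 : R) -> map_mx q X = 0.
Proof.
move=> X0; apply/matrixP => i j; rewrite !mxE; apply/q_ker/negligibleP.
by apply: dominated_cvg0 X0 => k; rewrite entry_rank_ge0 rel_rank_entry.
Qed.

(** Multiplication does not increase ranks, and matrices of sequences that agree
    in V differ by a negligible rank. *)
Lemma rel_rank_asymp_le m n m' n' (X : 'M[P]_(m, n)) (Y : 'M[P]_(m', n'))
    (A : 'M[V]_(m, m')) (B : 'M[V]_(n', n)) :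
  map_mx q X = A *m map_mx q Y *m B ->
  asymp_le (rel_rank R X) (rel_rank R Y).
Proof.
have [A' <-] := lift_mx A; have [B' <-] := lift_mx B; rewrite -!map_mxM => XE.
have Z0 : map_mx q (X - A' *m Y *m B') = 0 by rewrite raddfB /= XE subrr.
exists (rel_rank R (X - A' *m Y *m B')); first exact: rel_rank_cvg0.
move=> k; rewrite -[in leLHS](subrK (A' *m Y *m B') X) addrC.
apply: le_trans (rel_rankD _ _ _ _) _; rewrite lerD2r.
exact: le_trans (rel_rankMl _ _ _ _) (rel_rankMr _ _ _ _).
Qed.

(** A sequence of matrices of asymptotically full rank differs by a sequence of
    small rank from a sequence of invertible ones. *)
Lemma rel_rank_full_inverse m (M : 'M[P]_m) :
  rel_rank R M @ \oo --> (m%:R : R) -> exists N, inverse_mx (map_mx q M) N.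
Proof.
move=> Mm; pose F k := flatten_mx M k.
(* F k is col_ebase * pid_mx r * row_ebase with r its rank; N inverts the
   product of the two outer factors, and M N - 1 and N M - 1 are conjugates of
   pid_mx r - 1. *)
pose N : 'M[P]_m := unflatten_mx
  (fun k => invmx (row_ebase (F k)) *m invmx (col_ebase (F k))).
have def0 : (fun k => m%:R - rel_rank R M k) @ \oo --> (0 : R).
  by rewrite -[0](subrr m%:R); apply: cvgB => //; exact: cvg_cst.
have defect k (U : 'M[K]_(\sum_(i < m) d k)) : U \in unitmx ->
    (\rank (U *m copid_mx (\rank (F k)) *m invmx U))%:R / (d k)%:R =
    m%:R - rel_rank R M k :> R.
  move=> Uu; have dk0 : (d k)%:R != 0 :> R by rewrite pnatr_eq0 -lt0n.
  rewrite mxrankMfree ?row_free_unit ?unitmx_inv // eqmxMfull ?row_full_unit //.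
  rewrite rank_copid_mx ?rank_leq_row // natrB ?rank_leq_row // mulrBl.
  by congr (_ + _); rewrite sum_nat_const card_ord natrM mulfK.
have small (Y : 'M[P]_m) :
    (forall k, rel_rank R (Y - 1%:M) k = m%:R - rel_rank R M k) ->
    map_mx q Y = 1%:M.
  move=> Yk; apply/eqP; rewrite -subr_eq0 -(map_mx1 q) -raddfB; apply/eqP.
  by apply: map_mx_eq0; move/funext: Yk => ->.
have FE k : F k = col_ebase (F k) *m pid_mx (\rank (F k)) *m row_ebase (F k).
  by rewrite mulmx_ebase.
exists (map_mx q N); split; rewrite -map_mxM; apply: small => k;
  rewrite -rel_rankN opprB {1}/rel_rank flatten_mxD flatten_mxN flatten_mx1;
  rewrite flatten_mxM unflatten_mxK -/(F k).
- rewrite -(defect k (col_ebase (F k))) ?col_ebase_unit //.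
  congr ((\rank _)%:R / _); rewrite /copid_mx mulmxBr mulmx1 mulmxBl.
  rewrite mulmxV ?col_ebase_unit // {1}FE -!mulmxA mulKVmx ?row_ebase_unit //.
- rewrite -(defect k (invmx (row_ebase (F k)))) ?unitmx_inv ?row_ebase_unit //.
  congr ((\rank _)%:R / _); rewrite invmxK /copid_mx mulmxBr mulmx1 mulmxBl.
  rewrite mulVmx ?row_ebase_unit // {3}FE -!mulmxA mulKmx ?col_ebase_unit //.
Qed.

End AsymptoticRank.

(** * Existence of the limit *)

Section RationalClosureOfGroup.
Variables (K : fieldType) (G : groupType) (V : algType K) (f : G -> V).
Variables (D : unitAlgType K) (i : {lrmorphism D -> V}) (theta : G -> D).
Hypothesis thetaE : forall g, i (theta g) = f g.

Lemma linear_extension_lift a :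
  i (linear_extension theta a) = linear_extension f a.
Proof.
rewrite -(linear_extension_comp theta (h := i)) ?raddf0 //.
- by congr linear_extension; apply/funext => g; rewrite thetaE.
- exact: raddfD.
- by move=> k; exact: linearZ.
Qed.

Hypotheses (skewD : skew_field D) (i_inj : injective i)
  (i_im : forall x, rational (in_span f) x <-> exists d, x = i d).

(** A rational element is obtained from entries in the image of the group
    algebra by inverting a matrix, and over a skew field matrix inversion only
    uses the operations under which a division subring is closed. *)
Lemma rational_closure_generating : generating theta.
Proof.
move=> S Sdiv SA x.
have [|m [M [N [c [b [MB cB bB MNK xE]]]]]] := (proj2 (i_im (i x))).
  by exists x.
have lift m' n' (A : 'M[V]_(m', n')) : entries_in (in_span f) A ->
    exists2 A' : 'M[D]_(m', n'), A = map_mx i A' & forall u v, A' u v \in S.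
  move=> /in_span_mx[A' ->]; exists (map_mx (linear_extension theta) A').
    by apply/matrixP => u v; rewrite !mxE linear_extension_lift.
  by move=> u v; rewrite mxE SA.
have [M' ME M'S] := lift _ _ _ MB; have [c' cE c'S] := lift _ _ _ cB.
have [b' bE b'S] := lift _ _ _ bB.
have M'inj : left_injective M'.
  move=> w wM; have /rowP iw0 : map_mx i w = 0.
    by apply: (inverse_left_injective MNK); rewrite ME -map_mxM wM map_mx0.
  by apply/rowP => j; apply: i_inj; have := iw0 j; rewrite !mxE rmorph0.
have [N' N'S M'N'] := left_injective_inverse skewD Sdiv M'S M'inj.
have NE : N = map_mx i N'.
  have [_ NM] := MNK; rewrite -[LHS]mulmx1 -(map_mx1 i) -(proj1 M'N').
  by rewrite map_mxM -ME mulmxA NM mul1mx.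
pose S' : divringClosed D :=
  HB.pack (S : D -> bool) (GRing.isDivringClosed.Build D S Sdiv).
have -> : x = (c' *m N' *m b') 0 0.
  apply: i_inj; move: xE; rewrite cE NE bE -!map_mxM => /matrixP/(_ 0 0).
  by rewrite !mxE eqxx.
suff : c' *m N' *m b' \is a mxOver S' by move/mxOverP; apply.
by rewrite !mxOverM //; apply/mxOverP.
Qed.

End RationalClosureOfGroup.

Section LimitExistence.
Variables (R : realType) (K : fieldType) (G : groupType).
Variable thetas : nat -> fd_representation K G.
Hypotheses (thetas_cvg : convergent R thetas)
  (thetas_int : atiyah_condition R thetas).
Local Open Scope classical_set_scope.

Let d k := fd_dim (thetas k).
Let d_gt0 k : (0 < d k)%N. Proof. exact: fd_dim_gt0. Qed.
Notation P := (mxseq K d).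
Let rep_seq (g : G) : P := fun k => thetas k g.

Let fd_rkE n (A : 'M[group_algebra K G]_n) :
  (fun k => fd_rk R (thetas k) A) =
  rel_rank R (map_mx (linear_extension rep_seq) A).
Proof.
apply/funext => k; rewrite /fd_rk /rel_rank /fd_ext /flatten_mx.
congr ((\rank _)%:R / _); apply: eq_mxblock => i j; rewrite mxE.
by rewrite -(linear_extension_comp rep_seq (h := fun x : P => x k)).
Qed.

Let lim_rank n (A : 'M[group_algebra K G]_n) : (0 < n)%N ->
  exists2 z : int, rel_rank R (map_mx (linear_extension rep_seq) A) @ \oo
    --> (z%:~R : R) & (fun k => fd_rk R (thetas k) A) @ \oo --> (z%:~R : R).
Proof.
move=> n0; have /intrP[z zE] := thetas_int A n0.
have /cvg_ex[l lA] := @thetas_cvg n A n0.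
have lz : l = z%:~R by rewrite -zE; apply/esym/cvg_lim.
by exists z; rewrite -?fd_rkE -lz.
Qed.

Variables (V : algType K) (q : {rmorphism P -> V}).
Hypotheses (qZ : forall a x, q (a *: x) = a *: q x)
  (q_surj : forall v, exists x, q x = v)
  (q_ker : forall x, q x = 0 <-> x \in negligible R (K := K) (d := d)).

Let f g : V := q (rep_seq g).

Let lextE a : linear_extension f a = q (linear_extension rep_seq a).
Proof.
by apply: linear_extension_comp => [|x y|k x]; rewrite ?rmorph0 ?rmorphD ?qZ.
Qed.

Let map_lextE m n (A : 'M[group_algebra K G]_(m, n)) :
  map_mx (linear_extension f) A =
  map_mx q (map_mx (linear_extension rep_seq) A).
Proof. by apply/matrixP => i j; rewrite !mxE lextE. Qed.

(** Row and column operations over V turn the bordered matrix into the diagonal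
    matrix with entries 1 (m times) and x = c N b, so its limit rank is m plus
    the limit rank of x; being an integer, it is m + 1 or m, and in the second
    case x has limit rank 0. *)
Lemma limit_rank_dichotomy : bordered_dichotomy (in_span f).
Proof.
move=> m M N c b MB cB bB [MN NM].
have [T TE] := in_span_mx (bordered_entries (in_span0 f) MB cB bB).
have m1 : (0 < m + 1)%N by rewrite addn1.
have [z rz _] := lim_rank T m1.
pose Y := map_mx (linear_extension rep_seq) T.
have YE : bordered M c b = map_mx q Y by rewrite TE map_lextE.
have zm1 : (z <= (m + 1)%:Z)%R.
  rewrite -(ler_int R); apply: (asymp_le_lim (u := rel_rank R Y) _ rz).
    exists (cst 0); first exact: cvg_cst.
    by move=> k; rewrite /= addr0; apply: (rel_rank_max _ d_gt0).
  exact: cvg_cst.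
(* z is the limit rank: full if m < z, and otherwise equal to m. *)
have [zm | mz] := leP z m%:Z; last first.
  right; rewrite YE; apply: (rel_rank_full_inverse (R := R) d_gt0 q_ker).
  rewrite (_ : (m + 1)%:R = z%:~R :> R) //.
  rewrite -[LHS]/((m + 1)%:Z%:~R); congr (_%:~R); apply/eqP.
  by rewrite eq_le zm1 andbT addn1 -addn1 PoszD lezD1.
left; have [x xE] := q_surj ((c *m N *m b) 0 0).
have cNbE : c *m N *m b = (q x)%:M by rewrite xE -mx11_scalar.
rewrite cNbE; suff -> : q x = 0 by apply/matrixP => i j; rewrite !mxE mul0rn.
apply/q_ker/negligibleP.
pose X : 'M[P]_(m + 1) := diag_mx (row_mx (const_mx 1) (const_mx x)).
have XE : map_mx q X = block_mx N 0 (c *m N) (- 1%:M) *m map_mx q Y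
    *m block_mx 1%:M (- (N *m b)) 0 1%:M.
  rewrite -YE /bordered.
  have -> : block_mx N 0 (c *m N) (- 1%:M) *m block_mx M b c 0 =
      block_mx 1%:M (N *m b) 0 (q x)%:M.
    rewrite mulmx_block !(mulmx0, mul0mx, addr0) NM -cNbE -!(mulmxA c) NM.
    by rewrite mulmx1 mulNmx mul1mx subrr.
  rewrite mulmx_block !(mulmx0, mul0mx, mulmx1, mul1mx, addr0, add0r) addNr.
  apply/matrixP => i j; rewrite !mxE rmorphMn /=.
  case: splitP => i' ii'; rewrite !mxE; case: splitP => j' jj';
    rewrite !mxE -?val_eqE /= ?ii' ?jj' ?ord1 ?eqxx ?mulr1n ?rmorph1 //.
  - by rewrite addn0 (ltn_eqF (ltn_ord i')) mulr0n.
  - by rewrite addn0 (gtn_eqF (ltn_ord j')) mulr0n.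
have Xrank k : rel_rank R X k = m%:R + entry_rank R x k.
  rewrite rel_rank_diag big_split_ord /= big_ord1 row_mxEr mxE; congr (_ + _).
  rewrite -(rel_rank1 R K d_gt0 m k) -diag_const_mx rel_rank_diag.
  by apply: eq_bigr => i _; rewrite row_mxEl !mxE.
have [e e0 XY] := rel_rank_asymp_le q_surj q_ker XE.
have mz : (m%:R : R) <= z%:~R.
  apply: (asymp_le_lim (u := cst m%:R) (v := rel_rank R Y) _ _ rz).
    exists e => // k; apply: le_trans (XY k).
    by rewrite Xrank lerDl entry_rank_ge0.
  exact: cvg_cst.
have zE : z%:~R = m%:R :> R.
  by apply: le_anti; rewrite mz andbT -[m%:R]/(m%:Z%:~R) ler_int.
have bound : (fun k => rel_rank R Y k - m%:R + e k) @ \oo --> (0 : R).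
  rewrite -[0](addr0 (0 : R)); apply: cvgD => //.
  rewrite -(subrr (m%:R : R)); apply: cvgB; last exact: cvg_cst.
  by rewrite -zE.
apply: dominated_cvg0 bound => k; rewrite entry_rank_ge0 /=.
by rewrite addrAC lerBrDl -Xrank.
Qed.

Variables (D : unitAlgType K) (i : {lrmorphism D -> V}) (theta : G -> D).
Hypotheses (skewD : skew_field D) (i_inj : injective i)
  (thetaE : forall g, i (theta g) = f g).

Let map_lext_theta m n (A : 'M[group_algebra K G]_(m, n)) :
  map_mx i (map_mx (linear_extension theta) A) =
  map_mx q (map_mx (linear_extension rep_seq) A).
Proof.
rewrite -map_lextE; apply/matrixP => u v.
by rewrite !mxE (linear_extension_lift thetaE).
Qed.

Let i1 : i 1 = 1. Proof. exact: rmorph1. Qed.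

Lemma embedded_hom : hom_to_nonzero theta.
Proof.
have theta1 : theta 1%g = 1.
  apply: i_inj; rewrite thetaE i1 /f -[RHS](rmorph1 q); congr (q _).
  by apply: functional_extensionality_dep => k; exact: fd_one.
have thetaM g h : theta (g * h)%g = theta g * theta h.
  apply: i_inj; rewrite rmorphM /= !thetaE /f -rmorphM; congr (q _).
  by apply: functional_extensionality_dep => k; exact: fd_mul.
split=> // g; apply/eqP => g0; have /eqP := theta1.
by rewrite -(mulgV g) thetaM g0 mul0r eq_sym oner_eq0.
Qed.

Lemma embedded_limit : limit_hom R thetas theta.
Proof.
move=> n A n0; have [z rz fz] := lim_rank A n0.
set AD := map_mx _ A; set s := skew_rank AD.
have [T [U [E [X [ATU EAX]]]]] := skew_rank_factor skewD AD.
(* AD = T U factors through 1 of size s, which in turn is E AD X. *)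
have one_s : map_mx q (1%:M : 'M[P]_s) = map_mx i (1%:M : 'M[D]_s).
  by rewrite !map_mx1.
have rank_s : rel_rank R (1%:M : 'M[P]_s) @ \oo --> (s%:R : R).
  rewrite (_ : rel_rank R _ = cst s%:R); first exact: cvg_cst.
  by apply/funext => k; rewrite rel_rank1.
suff -> : s%:R = z%:~R :> R by [].
apply: le_anti; apply/andP; split.
  apply: (asymp_le_lim _ rank_s rz).
  apply: (rel_rank_asymp_le q_surj q_ker (A := map_mx i E) (B := map_mx i X)).
  by rewrite -map_lext_theta -/AD one_s -EAX !map_mxM.
apply: (asymp_le_lim _ rz rank_s).
apply: (rel_rank_asymp_le q_surj q_ker (A := map_mx i T) (B := map_mx i U)).
by rewrite -map_lext_theta -/AD one_s map_mx1 mulmx1 -map_mxM -ATU.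
Qed.

End LimitExistence.

Lemma limit_hom_exists (R : realType) (K : fieldType) (G : groupType)
    (thetas : nat -> fd_representation K G) :
  convergent R thetas -> atiyah_condition R thetas ->
  exists (D : unitAlgType K) (theta : G -> D),
    [/\ skew_field D, hom_to_nonzero theta, limit_hom R thetas theta &
        generating theta].
Proof.
move=> thetas_cvg thetas_int.
have [V [q [qZ q_surj q_ker]]] :=
  rank_quotient R K (fun k => fd_dim_gt0 (thetas k)).
pose f g : V := q (fun k => thetas k g).
have f1 : in_span f 1.
  suff -> : 1 = f 1%g by exact: in_span_gen.
  rewrite -[LHS](rmorph1 q); congr (q _).
  by apply: functional_extensionality_dep => k; rewrite fd_one.
have [D [i [skewD i_inj i_im]]] := rational_closure_skew_field (in_span0 f) f1
  (@in_spanZ _ _ _ f)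
  (limit_rank_dichotomy thetas_cvg thetas_int qZ q_surj q_ker).
have /choice[theta thetaE] g : exists x, i x = f g.
  have /i_im[x ->] : rational (in_span f) (f g).
    exact: (rational_gen (in_span0 f) f1 (in_span_gen f g)).
  by exists x.
exists D, theta; split=> //.
- exact: embedded_hom i_inj thetaE.
- exact: (embedded_limit thetas_cvg thetas_int qZ q_surj q_ker skewD thetaE).
- exact: (rational_closure_generating thetaE skewD i_inj i_im).
Qed.

(** * Uniqueness of the limit *)

Lemma inverse_mx_pair (A A' : nzRingType) n (M : 'M[(A * A')%type]_n) N N' :
  inverse_mx (map_mx fst M) N -> inverse_mx (map_mx snd M) N' ->
  exists T, inverse_mx M T.
Proof.
move=> [MN NM] [MN' NM'].
have pairP (X Y : 'M[(A * A')%type]_n) :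
    map_mx fst X = map_mx fst Y -> map_mx snd X = map_mx snd Y -> X = Y.
  move=> /matrixP e1 /matrixP e2; apply/matrixP => i j.
  have := e1 i j; have := e2 i j; rewrite !mxE.
  by case: (X i j) (Y i j) => [x x'] [y y'] /= -> ->.
pose T : 'M[(A * A')%type]_n := \matrix_(i, j) (N i j, N' i j).
have T1 : map_mx fst T = N by apply/matrixP => i j; rewrite !mxE.
have T2 : map_mx snd T = N' by apply/matrixP => i j; rewrite !mxE.
exists T; split; apply: pairP; rewrite map_mxM map_mx1 ?T1 ?T2 //.
Qed.

(** A row killed by the bordered matrix has the form (- v c N, v) with
    v (c N b) = 0. *)
Lemma bordered_left_injective (K : fieldType) (D : unitAlgType K) m
    (M N : 'M[D]_m) (c : 'rV[D]_m) (b : 'cV[D]_m) :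
  skew_field D -> inverse_mx M N -> c *m N *m b != 0 ->
  left_injective (bordered M c b).
Proof.
move=> skewD [MN _] cNb0 w; rewrite -[w]hsubmxK.
set u := lsubmx w; set v := rsubmx w.
rewrite mul_row_block mulmx0 addr0 -row_mx0 => /eq_row_mx[uM ub].
have uE : u = - (v *m c *m N).
  have /(congr1 (mulmx^~ N)) /= := uM; rewrite mulmxDl mul0mx -(mulmxA u) MN.
  by rewrite mulmx1 => /(canRL (addrK _)); rewrite sub0r.
have scal0 (s t : D) : t != 0 -> s%:M *m t%:M = 0 :> 'M[D]_1 -> s = 0.
  rewrite -scalar_mxM => /skewD tU /matrixP/(_ 0 0).
  by rewrite !mxE eqxx !mulr1n => st0; rewrite -[s](mulrK tU) st0 mul0r.
have v0 : v = 0.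
  have x0 : (c *m N *m b) 0 0 != 0.
    apply: contraNneq cNb0 => x0.
    by rewrite [_ *m b]mx11_scalar x0 raddf0.
  rewrite [v]mx11_scalar (scal0 (v 0 0) _ x0) ?raddf0 // -!mx11_scalar.
  move: ub; rewrite uE mulNmx => /eqP; rewrite oppr_eq0 => /eqP.
  by rewrite !mulmxA.
by rewrite uE v0 !mul0mx oppr0.
Qed.

(** A homomorphism from a skew field is injective and its image is closed under
    division, so it is onto as soon as it contains a generating set. *)
Lemma skew_field_hom_bijective (K : fieldType) (G : groupType)
    (E D : unitAlgType K) (j : {lrmorphism E -> D}) (theta : G -> D) :
  skew_field E -> generating theta -> (forall g, exists e, j e = theta g) ->
  bijective j.
Proof.
move=> skewE gen /choice[eta etaE].
have j_inj : injective j.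
  apply: raddf_inj => e je0; apply/eqP; apply/negPn/negP => /skewE eU.
  have /eqP := rmorph1 j; rewrite -(mulrV eU) rmorphM /= je0 mul0r.
  by rewrite eq_sym oner_eq0.
pose S : {pred D} := [pred x | `[< exists e, j e = x >]].
have SP x : reflect (exists e, j e = x) (x \in S) by exact: asboolP.
have /choice[h hE] x : exists e, j e = x.
  apply/SP/gen => [|a]; last first.
    apply/SP; exists (linear_extension eta a).
    exact: linear_extension_lift.
  split=> [|_ _ /SP[e <-] /SP[e' <-]|_ _ /SP[e <-] /SP[e' <-]]; apply/SP.
  - by exists 1; rewrite rmorph1.
  - by exists (e - e'); rewrite rmorphB.
  - have [-> | e0] := eqVneq e' 0.
      by exists 0; rewrite !rmorph0 invr0 mulr0.
    by exists (e / e'); rewrite rmorphM /= rmorphV // skewE.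
by exists h => x; [apply: j_inj; rewrite hE | exact: hE].
Qed.

Section LimitUniqueness.
Variables (K : fieldType) (G : groupType) (D D' : unitAlgType K).
Variables (theta : G -> D) (theta' : G -> D').
Hypotheses (skewD : skew_field D) (skewD' : skew_field D')
  (theta1 : theta 1%g = 1) (theta'1 : theta' 1%g = 1).
Hypothesis rank_eq : forall n (A : 'M[group_algebra K G]_n), (0 < n)%N ->
  skew_rank (map_mx (linear_extension theta) A) =
  skew_rank (map_mx (linear_extension theta') A).

Let V : algType K := (D * D')%type.
Let f g : V := (theta g, theta' g).

Let lext_fst a : (linear_extension f a).1 = linear_extension theta a.
Proof. by rewrite -(linear_extension_comp f (h := fst)). Qed.

Let lext_snd a : (linear_extension f a).2 = linear_extension theta' a.
Proof. by rewrite -(linear_extension_comp f (h := snd)). Qed.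

(** A bordered matrix over the product with non-zero Schur complement has full
    rank over one factor, hence over both because the ranks agree. *)
Lemma equal_rank_dichotomy : bordered_dichotomy (in_span f).
Proof.
move=> m M N c b MB cB bB MNK.
have [T TE] := in_span_mx (bordered_entries (in_span0 f) MB cB bB).
have [-> | cNb0] := eqVneq (c *m N *m b) 0; [by left | right].
have T1 : map_mx fst (bordered M c b) = map_mx (linear_extension theta) T.
  by rewrite TE; apply/matrixP => i j; rewrite !mxE lext_fst.
have T2 : map_mx snd (bordered M c b) = map_mx (linear_extension theta') T.
  by rewrite TE; apply/matrixP => i j; rewrite !mxE lext_snd.
have m1 : (0 < m + 1)%N by rewrite addn1.
have K1 := map_inverse_mx (fst : {rmorphism V -> D}) MNK.
have K2 := map_inverse_mx (snd : {rmorphism V -> D'}) MNK.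
have [inj1 inj2] : left_injective (map_mx fst (bordered M c b)) /\
    left_injective (map_mx snd (bordered M c b)).
  rewrite T1 T2 -!skew_rank_full // rank_eq //.
  suff : skew_rank (map_mx (linear_extension theta) T) = (m + 1)%N \/
      skew_rank (map_mx (linear_extension theta') T) = (m + 1)%N.
    by rewrite rank_eq // => -[].
  rewrite !skew_rank_full // -T1 -T2 /bordered !map_block_mx !map_mx0.
  have [cNb1 | cNb1] := eqVneq (map_mx fst (c *m N *m b)) 0; last first.
    by left; apply: bordered_left_injective K1 _; rewrite // -!map_mxM.
  right; apply: bordered_left_injective K2 _; rewrite // -!map_mxM.
  move: (c *m N *m b) cNb1 cNb0 => X X1; apply: contraNneq => X2.
  apply/eqP/matrixP => i j; have /matrixP/(_ i j) := X1.
  have /matrixP/(_ i j) := X2; rewrite !mxE.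
  by case: (X i j) => x y /= -> ->.
have trueS (A : unitAlgType K) k (X : 'M[A]_k) i j : X i j \in predT by [].
have [N1 _ N1K] := left_injective_inverse skewD (divring_closed_predT _)
  (trueS _ _ _) inj1.
have [N2 _ N2K] := left_injective_inverse skewD' (divring_closed_predT _)
  (trueS _ _ _) inj2.
exact: inverse_mx_pair N1K N2K.
Qed.

(** The rational closure of the group in D * D' is the graph of the
    isomorphism: it is a skew field that projects isomorphically onto each
    factor. *)
Lemma equal_rank_isomorphic : generating theta -> generating theta' ->
  exists2 pi : {lrmorphism D -> D'},
    bijective pi & forall g, pi (theta g) = theta' g.
Proof.
move=> gen gen'.
have f1 : in_span f 1.
  by suff -> : 1 = f 1%g :> V; [exact: in_span_gen | rewrite /f theta1 theta'1].
have [E [i [skewE i_inj i_im]]] := rational_closure_skew_field (in_span0 f) f1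
  (@in_spanZ _ _ _ f) equal_rank_dichotomy.
have eta g : exists e, i e = f g.
  have /i_im[x ->] := rational_gen (in_span0 f) f1 (in_span_gen f g).
  by exists x.
have [j jE] : exists j : {lrmorphism E -> D}, forall e, j e = (i e).1.
  by exists ((fst : {lrmorphism V -> D}) \o i).
have [j' j'E] : exists j' : {lrmorphism E -> D'}, forall e, j' e = (i e).2.
  by exists ((snd : {lrmorphism V -> D'}) \o i).
have [h jK hK] : bijective j.
  apply: skew_field_hom_bijective gen _ => // g.
  by have [e ie] := eta g; exists e; rewrite jE ie.
have [h' j'K h'K] : bijective j'.
  apply: skew_field_hom_bijective gen' _ => // g.
  by have [e ie] := eta g; exists e; rewrite j'E ie.
have hL a x y : h (a *: x + y) = a *: h x + h y.
  by apply: (can_inj jK); rewrite linearP /= !hK.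
have h1 : h 1 = 1 by apply: (can_inj jK); rewrite hK rmorph1.
have hM x y : h (x * y) = h x * h y.
  by apply: (can_inj jK); rewrite rmorphM /= !hK.
have piL : linear (j' \o h) by move=> a x y; rewrite [LHS]/= hL linearP.
have piM : monoid_morphism (j' \o h).
  by split=> [|x y]; rewrite [LHS]/= ?h1 ?rmorph1 // hM rmorphM.
pose pi : {lrmorphism D -> D'} := HB.pack (j' \o h)
  (GRing.isLinear.Build K D D' *:%R (j' \o h) piL)
  (GRing.isMonoidMorphism.Build D D' (j' \o h) piM).
exists pi.
  by exists (j \o h') => x /=; rewrite ?j'K ?hK ?jK ?h'K.
move=> g; have [e ie] := eta g.
have -> : theta g = j e by rewrite jE ie.
by rewrite /= jK j'E ie.
Qed.

End LimitUniqueness.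

Theorem theorem2 (R : realType) (K : finFieldType) (r : nat)
    (thetas : nat -> fd_representation K (free_group r)) :
  convergent R thetas -> atiyah_condition R thetas ->
  exists (D : unitAlgType K) (theta : free_group r -> D),
    [/\ skew_field D, hom_to_nonzero theta,
        limit_hom R thetas theta, generating theta &
        forall (D' : unitAlgType K) (theta' : free_group r -> D'),
          skew_field D' -> hom_to_nonzero theta' ->
          limit_hom R thetas theta' -> generating theta' ->
          exists2 pi : {lrmorphism D -> D'},
            bijective pi & forall g, pi (theta g) = theta' g].
Proof.
move=> thetas_cvg thetas_int.
have [D [theta [skewD homD limD genD]]] :=
  limit_hom_exists thetas_cvg thetas_int.
exists D, theta; split=> // D' theta' skewD' homD' limD' genD'.
have [_ theta1 _] := homD; have [_ theta'1 _] := homD'.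
apply: equal_rank_isomorphic => // n A n0; apply/eqP.
rewrite -(eqr_nat R) -(cvg_lim _ (limD n A n0)) //.
by rewrite -(cvg_lim _ (limD' n A n0)).
Qed.
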